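(* Let $D=\{(x,z):\ -1<z<0,\ -1<x<z+1\}$, and for $\lambda\in(\tfrac12,\tfrac45)$ let $a=\sqrt{\lambda/(1-\lambda)}$, $P(\lambda)=\{(x,z):\ a-3+\tfrac1a<z-\tfrac{x}{a}<1-a+\tfrac1a,\ 1-a-\tfrac1a<z+\tfrac{x}{a}<a-1-\tfrac1a\}$ and $\chi(x,z,\lambda)$ the indicator of $P(\lambda)$ in $D$. Let $\tfrac12<\lambda_*<\lambda_{**}<\tfrac45$, $\sigma_0\in C^1[\tfrac12,\tfrac45]$, $\psi(x,z,t)=\int_{\lambda_*}^{\lambda_{**}}\cos(\sqrt\lambda\,t)\sigma_0(\lambda)\chi(x,z,\lambda)\,d\lambda$, and $\mathbf U=(u,v,w)$ with $u=-\psi_z$, $v=\int_0^t\psi_z(x,z,s)\,ds$, $w=\psi_x$. For $\mu\in[\lambda_*,\lambda_{**}]$ let $CA(\mu),AB(\mu),BD(\mu),DC(\mu)$ be the sides of $\overline{P(\mu)}$ lying on the lines $z=1+\frac xa+\frac1a-a$, $z=1-\frac xa-\frac1a-a$, $z=\frac xa+\frac1a+a-3$, $z=-\frac xa-\frac1a+a-1$ respectively ($a=a(\mu)$), and let $\Sigma_{CA}=\bigcup_{\mu\in[\lambda_*,\lambda_{**}]}CA(\mu)$, and similarly $\Sigma_{AB},\Sigma_{BD},\Sigma_{DC}$. Let $D_1,D_2,D_3,D_4$ be the interiors of $\Sigma_{CA}\cap\Sigma_{DC}$, $\Sigma_{CA}\cap\Sigma_{AB}$, $\Sigma_{AB}\cap\Sigma_{BD}$,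 $\Sigma_{BD}\cap\Sigma_{DC}$, and let $\Omega_0$ be the interior of $D\setminus(D_1\cup D_2\cup D_3\cup D_4)$ (equivalently $\Omega_0$ is, up to the common boundaries, $\bigcup_{i=5}^{13}D_i$). Then $\mathbf U$ has property $S$ in $\Omega_0$: for every Lipschitz subdomain $\Omega_1\subset\Omega_0$ the quantity $\int_{\Omega_1}(|u|^2+|v|^2+|w|^2)\,dx\,dz$ does not depend on $t$.
   Context: In the paper, $S(\lambda_* )=\partial P(\lambda_* )$ and $S(\lambda_{**})=\partial P(\lambda_{**})$ divide $D$ into subdomains $D_1,\dots,D_{13}$: $D_1,\dots,D_4$ are the four corner regions where two of the swept strips of sides overlap, $D_5,\dots,D_8$ are the parts of the four strips swept by a single side, and $D_9,\dots,D_{13}$ are the regions not met by any $S(\mu)$, $\mu\in[\lambda_*,\lambda_{**}]$. $\mathbf U$ is the velocity field (inertial wave) of the linearized rotating-fluid system $u_t=v-p_x$, $v_t=-u$, $w_t=-p_z$, $u_x+w_z=0$ with no-flux boundary condition, associated with the stream function $\psi$. *)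

(* Defs.v *)
(* R : realType, points of the (x,z)-plane are pairs p : R * R
   with p.1 = x and p.2 = z. *)
From HB Require Import structures.
From mathcomp Require Import all_boot all_order all_algebra.
From mathcomp Require Import all_classical all_reals all_analysis.
Set Implicit Arguments. Unset Strict Implicit. Unset Printing Implicit Defensive.
Import Order.TTheory GRing.Theory Num.Theory.
Import numFieldNormedType.Exports.
Local Open Scope classical_set_scope.
Local Open Scope ring_scope.

Section Defs.
Variable R : realType.

Definition domD : set (R * R) :=
  [set p | -1 < p.2 < 0 /\ -1 < p.1 < p.2 + 1].

Definition aof (l : R) : R := Num.sqrt (l / (1 - l)).

Definition Pset (l : R) : set (R * R) :=
  let a := aof l in
  [set p | a - 3 + a^-1 < p.2 - p.1 / a < 1 - a + a^-1 /\
           1 - a - a^-1 < p.2 + p.1 / a < a - 1 - a^-1].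

Definition chi (p : R * R) (l : R) : R :=
  if `[< (Pset l `&` domD) p >] then 1 else 0.

Definition psi (sigma0 : R -> R) (l1 l2 : R) (p : R * R) (t : R) : R :=
  Rintegral (@lebesgue_measure R) `[l1, l2]
    (fun l => cos (Num.sqrt l * t) * sigma0 l * chi p l).

Definition oint0 (f : R -> R) (t : R) : R :=
  if 0 <= t then Rintegral (@lebesgue_measure R) `[0, t] f
  else - Rintegral (@lebesgue_measure R) `[t, 0] f.

Definition psi_z sigma0 l1 l2 (p : R * R) (t : R) : R :=
  derive1 (fun z => psi sigma0 l1 l2 (p.1, z) t) p.2.
Definition psi_x sigma0 l1 l2 (p : R * R) (t : R) : R :=
  derive1 (fun x => psi sigma0 l1 l2 (x, p.2) t) p.1.

Definition uU sigma0 l1 l2 p t : R := - psi_z sigma0 l1 l2 p t.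
Definition vU sigma0 l1 l2 p t : R := oint0 (fun s => psi_z sigma0 l1 l2 p s) t.
Definition wU sigma0 l1 l2 p t : R := psi_x sigma0 l1 l2 p t.

Definition sideCA (mu : R) : set (R * R) :=
  closure (Pset mu) `&` [set p | p.2 = 1 + p.1 / aof mu + (aof mu)^-1 - aof mu].
Definition sideAB (mu : R) : set (R * R) :=
  closure (Pset mu) `&` [set p | p.2 = 1 - p.1 / aof mu - (aof mu)^-1 - aof mu].
Definition sideBD (mu : R) : set (R * R) :=
  closure (Pset mu) `&` [set p | p.2 = p.1 / aof mu + (aof mu)^-1 + aof mu - 3].
Definition sideDC (mu : R) : set (R * R) :=
  closure (Pset mu) `&` [set p | p.2 = - (p.1 / aof mu) - (aof mu)^-1 + aof mu - 1].

Definition Sigma (side : R -> set (R * R)) (l1 l2 : R) : set (R * R) :=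
  \bigcup_(mu in `[l1, l2]) side mu.

Definition Omega0 (l1 l2 : R) : set (R * R) :=
  let D1 := interior (Sigma sideCA l1 l2 `&` Sigma sideDC l1 l2) in
  let D2 := interior (Sigma sideCA l1 l2 `&` Sigma sideAB l1 l2) in
  let D3 := interior (Sigma sideAB l1 l2 `&` Sigma sideBD l1 l2) in
  let D4 := interior (Sigma sideBD l1 l2 `&` Sigma sideDC l1 l2) in
  interior (domD `\` (D1 `|` D2 `|` D3 `|` D4)).

Definition C1_on (lo hi : R) (f : R -> R) : Prop :=
  {within `[lo, hi], continuous f} /\
  exists f' : R -> R, {within `[lo, hi], continuous f'} /\
    forall x, lo < x < hi -> derivable f x 1 /\ derive1 f x = f' x.

Definition lipschitz_fun (g : R -> R) : Prop :=
  exists L : R, forall y1 y2, `|g y1 - g y2| <= L * `|y1 - y2|.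

(* Lipschitz domain in the plane: a nonempty bounded connected open set whose boundary
   is locally (in a rotated Cartesian frame) the graph of a Lipschitz function,
   the domain lying on one side of it. *)
Definition lipschitz_domain (O : set (R * R)) : Prop :=
  open O /\ O !=set0 /\ connected O /\
  (exists M : R, forall p, O p -> `|p.1| <= M /\ `|p.2| <= M) /\
  forall p, (closure O `\` O) p ->
    exists (r c s : R) (g : R -> R),
      0 < r /\ c ^+ 2 + s ^+ 2 = 1 /\ lipschitz_fun g /\
      forall q, (q.1 - p.1) ^+ 2 + (q.2 - p.2) ^+ 2 < r ^+ 2 ->
        (O q <-> - s * q.1 + c * q.2 > g (c * q.1 + s * q.2)).

Definition energy sigma0 l1 l2 (O : set (R * R)) (t : R) : \bar R :=
  (\int[(@lebesgue_measure R) \x (@lebesgue_measure R)]_(p in O)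
     ((uU sigma0 l1 l2 p t) ^+ 2 + (vU sigma0 l1 l2 p t) ^+ 2
      + (wU sigma0 l1 l2 p t) ^+ 2)%:E)%E.

End Defs.

(* Main.v *)
(* At a fixed point p of D, the lines carrying the sides CA and BD leave p outside P(l) as soon as
   l exceeds a threshold depending on p, and those carrying AB and DC as long as l stays below one.
   Hence chi(p, l) = 1 iff l lies between the larger lower threshold and the smaller upper one,
   and psi(p, t) is the integral of cos(sqrt l t) sigma0(l) over that interval, cut to
   [l1, l2] = [lstar, lstarstar].  Both ends move with p only inside the corner regions: two
   adjacent sides pass through p, and nearby points behave in the same way.  In Omega0, off the
   eight lines carrying the sides of P(l1) and P(l2), at most one end l = l(p) moves, and then
   psi_z = l_z sigma0(l) cos(sqrt l t), psi_x = l_x sigma0(l) cos(sqrt l t) up to a common sign,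
   and v = l_z sigma0(l) sin(sqrt l t) / sqrt l.  The level line of l is a side of P(l), of slope
   +-1/a with 1 + 1/a^2 = 1/l, that is l_x^2 + l_z^2 = l_z^2 / l: the energy density itself is
   constant in time. *)
Require Import Defs.
From HB Require Import structures.
From mathcomp Require Import all_boot all_order all_algebra.
From mathcomp Require Import all_classical all_reals all_analysis.
From mathcomp Require Import measurable_realfun ring lra.
Import Order.TTheory GRing.Theory Num.Theory.
Import numFieldNormedType.Exports.
Local Open Scope classical_set_scope.
Local Open Scope ring_scope.

(** * Integrals that agree off a null set, and lines as null sets *)

Section NullSets.
Import HBNNSimple.

(* The integral of a nonnegative function, measurable or not, is a supremum over the simple
   functions below it, and these may be truncated to the complement of [N]. *)
Lemma ge0_le_integral_off_null d (T : measurableType d) (R : realType)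
    (mu : {measure set T -> \bar R}) (D N : set T) (f g : T -> \bar R) :
  measurable N -> mu N = 0%E ->
  (forall x, D x -> (0 <= f x)%E) -> (forall x, D x -> (0 <= g x)%E) ->
  (forall x, D x -> ~ N x -> f x = g x) ->
  (\int[mu]_(x in D) f x <= \int[mu]_(x in D) g x)%E.
Proof.
move=> mN N0 f0 g0 fg; rewrite !ge0_integralE//.
apply: ge_ereal_sup => _ [h /= hf <-].
have hE : proj_nnsfun h (measurableC mN) = h \_ (~` N) :> (T -> R).
  by rewrite (mrestrict h (measurableC mN)).
apply: ereal_sup_ubound => /=; exists (proj_nnsfun h (measurableC mN)).
  move=> x; have := hf x; rewrite (congr1 (fun k => k x) hE) /patch.
  case: ifPn => xD hx; case: ifPn => [|_].
  - by rewrite inE => xN; rewrite -fg//; exact: set_mem.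
  - by apply: g0; exact: set_mem.
  - by [].
  - by [].
rewrite hE -integral_nnsfun; last exact: measurableC.
rewrite -integralT_nnsfun -setTD; apply/esym.
apply: ge0_negligible_integral => //.
- by apply/measurable_EFinP; exact: measurable_funP.
- by move=> x _; rewrite lee_fin; exact: fun_ge0.
Qed.

(** Lets the energies at two times be compared pointwise off finitely many lines, without settling
    whether the density is measurable. *)
Lemma ge0_eq_integral_off_null d (T : measurableType d) (R : realType)
    (mu : {measure set T -> \bar R}) (D N : set T) (f g : T -> \bar R) :
  measurable N -> mu N = 0%E ->
  (forall x, D x -> (0 <= f x)%E) -> (forall x, D x -> (0 <= g x)%E) ->
  (forall x, D x -> ~ N x -> f x = g x) ->
  (\int[mu]_(x in D) f x = \int[mu]_(x in D) g x)%E.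
Proof.
move=> mN N0 f0 g0 fg; apply/eqP; rewrite eq_le.
by rewrite !(@ge0_le_integral_off_null _ _ _ _ _ N)// => x Dx Nx; rewrite fg.
Qed.

Definition line {R : realType} (a b c : R) : set (R * R) :=
  [set p | a * p.1 + b * p.2 + c = 0].

Lemma measurable_line {R : realType} (a b c : R) :
  measurable (line a b c : set (measurableTypeR R * measurableTypeR R)).
Proof.
have mf : measurable_fun [set: measurableTypeR R * measurableTypeR R]
    (fun p => a * p.1 + b * p.2 + c : R).
  apply: measurable_funD; last exact: measurable_cst.
  by apply: measurable_funD; apply: measurable_funM.
have := mf measurableT _ (measurable_set1 (0 : R)).
by rewrite setTI.
Qed.

(** As [b] is nonzero, every vertical section is a single point. *)
Lemma line_null {R : realType} (a b c : R) : b != 0 ->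
  ((@lebesgue_measure R) \x (@lebesgue_measure R))%E (line a b c) = 0%E.
Proof.
move=> b0; rewrite /product_measure1.
apply: integral0_eq => x _ /=.
rewrite (_ : xsection _ _ = [set - (a * x + c) / b]); first exact: lebesgue_measure_set1.
apply/seteqP; split=> [z|z ->]; rewrite /xsection /= inE /line /=.
  by move=> e; rewrite -[z](mulfK b0); congr (_ / _); lra.
by field.
Qed.

End NullSets.

(** * Integrals of cosines and derivatives in a moving endpoint *)

Section Potential.
Context {R : realType}.
Notation mu := (@lebesgue_measure R).

Lemma Rintegral_cos_mull (k w a b : R) : w != 0 -> a <= b ->
  Rintegral mu `[a, b] (fun s => k * cos (w * s)) =
    k * sin (w * b) / w - k * sin (w * a) / w.
Proof.
move=> w0; rewrite le_eqVlt => /predU1P[<-|ab].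
  by rewrite set_itv1 Rintegral_set1 subrr.
pose F (s : R) : R := k * sin (w * s) / w.
have dF (s : R) : is_derive s (1 : R) F (k * cos (w * s)).
  rewrite /F; apply: is_derive_eq; rewrite /GRing.scale /=; field; exact: w0.
have cF : continuous F.
  by move=> s; apply: differentiable_continuous; apply/derivable1_diffP; exact: ex_derive.
rewrite /Rintegral (@continuous_FTC2 _ _ F)//.
- apply: continuous_subspaceT => s; apply: cvgM; first exact: cvg_cst.
  apply: continuous_comp; last exact: continuous_cos.
  by apply: cvgM; [exact: cvg_cst|exact: cvg_id].
- split=> [s _||]; first exact: ex_derive.
  + by apply: cvg_at_right_filter; exact: cF.
  + by apply: cvg_at_left_filter; exact: cF.
- by move=> s _; rewrite derive1E; exact: derive_val.
Qed.

Lemma oint0_cos_mull (k w t : R) : w != 0 ->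
  oint0 (fun s => k * cos (w * s)) t = k * sin (w * t) / w.
Proof.
move=> w0; rewrite /oint0; have [t0|/ltW t0] := leP 0 t; rewrite Rintegral_cos_mull//.
  by rewrite mulr0 sin0 mulr0 mul0r subr0.
by rewrite mulr0 sin0 mulr0 mul0r sub0r opprK.
Qed.

Lemma derive_Rintegral_upper (g : R -> R) (a b c : R) :
  {within `[a, b], continuous g} -> a < c < b ->
  is_derive c (1 : R) (fun y => Rintegral mu `[a, y] g) (g c).
Proof.
move=> cg /andP[ac cb].
have ig : mu.-integrable `[a, b] (EFin \o g).
  by apply: continuous_compact_integrable => //; exact: segment_compact.
have cgc : {for c, continuous g}.
  by apply: (within_continuous_continuous (lt_trans ac cb)); rewrite ?in_itv/= ?ac.
have [dF F'] := continuous_FTC1_closed cb ig ac cgc.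
by apply: DeriveDef => //; rewrite -derive1E.
Qed.

Lemma Rintegral_itv_lower (g : R -> R) (a b c : R) :
  {within `[a, b], continuous g} -> a <= c <= b ->
  Rintegral mu `]c, b] g = Rintegral mu `[a, b] g - Rintegral mu `[a, c] g.
Proof.
move=> cg /andP[ac cb].
have ig : mu.-integrable `[a, b] (EFin \o g).
  by apply: continuous_compact_integrable => //; exact: segment_compact.
by rewrite Rintegral_itvB// bnd_simp.
Qed.

End Potential.

(** * The frequency at which a moving side passes through a point *)

Section Fronts.
Context {R : realType}.
Implicit Types (a b c k e l r : R) (p : R * R).

(* Equals [b / 2] when the discriminant is negative: it then lies below every [a > 1] at which
   it is used, as if there were no root. *)
Definition top_root b c : R := (b + Num.sqrt (b ^+ 2 + 4 * c)) / 2.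

Lemma top_root_eq b c : 0 <= b ^+ 2 + 4 * c ->
  top_root b c ^+ 2 - b * top_root b c - c = 0.
Proof.
move=> d0; have := sqr_sqrtr d0; rewrite /top_root.
move: (Num.sqrt _) => s sE.
have -> : ((b + s) / 2) ^+ 2 - b * ((b + s) / 2) - c = (s ^+ 2 - (b ^+ 2 + 4 * c)) / 4.
  by field.
by rewrite sE subrr mul0r.
Qed.

(** With real roots, the hypothesis makes the factor of the smaller root positive, so the other
    factor decides the sign. With a negative discriminant [Num.sqrt] is 0, the hypothesis reads b/2
    < a, and the polynomial is positive. *)
Lemma quadratic_sign b c a : b - Num.sqrt (b ^+ 2 + 4 * c) < 2 * a ->
  ((a ^+ 2 - b * a - c < 0) = (a < top_root b c)) *
  ((0 < a ^+ 2 - b * a - c) = (top_root b c < a)).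
Proof.
rewrite /top_root; have [d0|d0] := leP 0 (b ^+ 2 + 4 * c).
  have := sqr_sqrtr d0; move: (Num.sqrt _) => s sE bs.
  have -> : a ^+ 2 - b * a - c = (a - (b + s) / 2) * (a - (b - s) / 2).
    have -> : c = (s ^+ 2 - b ^+ 2) / 4 by rewrite sE; field.
    by field.
  have ps : 0 < a - (b - s) / 2 by lra.
  by rewrite pmulr_llt0// pmulr_lgt0// subr_lt0 subr_gt0.
rewrite ltr0_sqrtr// addr0 subr0 => ba.
have q0 : 0 < a ^+ 2 - b * a - c by nra.
rewrite q0; split; last by apply/esym; lra.
by rewrite (lt_gtF q0); apply/esym/negbTE; rewrite -leNgt; lra.
Qed.

(** Inverse of [aof] on a >= 0, obtained by solving a^2 = l/(1-l) for l. *)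
Definition freq a : R := a ^+ 2 / (1 + a ^+ 2).

Lemma freq_lt a b : 0 <= a -> 0 <= b -> (freq a < freq b) = (a < b).
Proof.
move=> a0 b0; have da : 0 < 1 + a ^+ 2 by nra.
have db : 0 < 1 + b ^+ 2 by nra.
rewrite /freq ltr_pdivrMr// mulrAC ltr_pdivlMr// -[RHS](@ltr_pXn2r R 2)//.
by apply/idP/idP; lra.
Qed.

Lemma freq_aof l : 0 < l < 1 -> freq (aof l) = l.
Proof.
move=> /andP[l0 l1]; rewrite /freq /aof sqr_sqrtr; last first.
  by rewrite divr_ge0; lra.
by field; rewrite subrK oner_eq0 lt0r_neq0// subr_gt0.
Qed.

Lemma aof_freq a : 0 <= a -> aof (freq a) = a.
Proof.
move=> a0; rewrite /aof /freq -[RHS]ger0_norm// -sqrtr_sqr; congr Num.sqrt.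
by field; nra.
Qed.

Lemma aof_gt1 l : 2^-1 < l < 1 -> 1 < aof l.
Proof.
move=> /andP[l0 l1]; rewrite -sqrtr1 /aof ltr_sqrt; last by rewrite divr_gt0; lra.
by rewrite ltr_pdivlMr; lra.
Qed.

(* Up to sign, [a] times the equation of the line carrying a side of [P], as a quadratic polynomial in [a]:
   [(k, e1, e2)] is [(1, -1, 1)] for CA, [(3, 1, -1)] for BD, [(1, -1, -1)] for AB and
   [(1, 1, 1)] for DC. *)
Definition sideq k (e1 e2 : R) p a : R := a ^+ 2 - (k + e1 * p.2) * a - e2 * (p.1 + 1).
(** For a side of [P] and a point of [D]: once above 1, the value of [a] at which the moving line of
    that side passes through [p]. *)
Definition front k (e1 e2 : R) p : R := top_root (k + e1 * p.2) (e2 * (p.1 + 1)).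
Definition discr k (e1 e2 : R) p : R := (k + e1 * p.2) ^+ 2 + 4 * (e2 * (p.1 + 1)).
Definition front_freq k (e1 e2 : R) p : R := freq (front k e1 e2 p).

(** Holds on the whole plane because [Num.sqrt] is continuous everywhere, including where the
    discriminant is negative. *)
Lemma continuous_front_freq k (e1 e2 : R) : continuous (front_freq k e1 e2).
Proof.
move=> p; have cB : {for p, continuous (fun q : R * R => k + e1 * q.2)}.
  by apply: cvgD; [exact: cvg_cst|apply: cvgM; [exact: cvg_cst|exact: cvg_snd]].
have cC : {for p, continuous (fun q : R * R => e2 * (q.1 + 1))}.
  by apply: cvgM; [exact: cvg_cst|apply: cvgD; [exact: cvg_fst|exact: cvg_cst]].
have cd : {for p, continuous (discr k e1 e2)}.
  apply: cvgD; first exact: cvgM.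
  by apply: cvgM; [exact: cvg_cst|exact: cC].
have cf : {for p, continuous (front k e1 e2)}.
  apply: cvgM; last exact: cvg_cst.
  apply: cvgD; first exact: cB.
  by apply: continuous_comp; [exact: cd|exact: sqrt_continuous].
have c2 : {for p, continuous (fun q => front k e1 e2 q ^+ 2)} by exact: cvgM.
apply: cvgM; first exact: c2.
apply: cvgV; first by rewrite lt0r_neq0// ltr_pwDl// sqr_ge0.
by apply: cvgD; [exact: cvg_cst|exact: c2].
Qed.

Lemma is_derive_freq a : is_derive a (1 : R) freq (2 * a / (1 + a ^+ 2) ^+ 2).
Proof.
have a0 : 1 + a ^+ 2 != 0 :> R by rewrite lt0r_neq0// ltr_pwDl// sqr_ge0.
rewrite /freq; apply: is_derive_eq.
by rewrite /GRing.scale /=; field.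
Qed.

(** Implicit differentiation of a^2 = b a + c: (2a - b) a' = a b' + c', where 2a - b is the root of
    the discriminant. *)
Lemma is_derive_top_root (b c : R -> R) (db dc t : R) :
  0 < b t ^+ 2 + 4 * c t -> is_derive t (1 : R) b db -> is_derive t (1 : R) c dc ->
  is_derive t (1 : R) (fun s => top_root (b s) (c s))
    ((top_root (b t) (c t) * db + dc) / Num.sqrt (b t ^+ 2 + 4 * c t)).
Proof.
move=> d0 hb hc.
have hs : is_derive t (1 : R) (fun s => Num.sqrt (b s ^+ 2 + 4 * c s))
   ((2 * Num.sqrt (b t ^+ 2 + 4 * c t))^-1 * (2 * b t * db + 4 * dc)).
  apply: (@is_derive1_comp R Num.sqrt (fun s => b s ^+ 2 + 4 * c s)).
    exact: is_derive1_sqrt.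
  apply: is_derive_eq; rewrite /GRing.scale /=; ring.
rewrite /top_root; apply: is_derive_eq; rewrite /GRing.scale /=.
have s0 : Num.sqrt (b t ^+ 2 + 4 * c t) != 0 by rewrite lt0r_neq0// sqrtr_gt0.
by field.
Qed.

(* The eikonal equation of the moving side: its slope is [+-1/a] with [1 + 1/a^2 = 1/l]. *)
Lemma front_freq_gradient k (e1 e2 : R) p :
  e1 ^+ 2 = 1 -> e2 ^+ 2 = 1 -> 0 < discr k e1 e2 p -> 0 < front k e1 e2 p ->
  exists dz dx : R,
    [/\ is_derive p.2 (1 : R) (fun z => front_freq k e1 e2 (p.1, z)) dz,
        is_derive p.1 (1 : R) (fun x => front_freq k e1 e2 (x, p.2)) dx &
        dx ^+ 2 + dz ^+ 2 = dz ^+ 2 / front_freq k e1 e2 p].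
Proof.
move=> e1E e2E d0 f0.
pose a := front k e1 e2 p; pose s := Num.sqrt (discr k e1 e2 p).
pose a' := 2 * a / (1 + a ^+ 2) ^+ 2.
(* Chain rule through [freq]. The ratio dx/dz is e2/(a e1), of square 1/a^2, and 1 + 1/a^2 is the
   inverse of the frequency. *)
exists (a' * ((a * e1 + 0) / s)), (a' * ((a * 0 + e2) / s)); split.
- have h : is_derive p.2 (1 : R) (fun z => front k e1 e2 (p.1, z)) ((a * e1 + 0) / s).
    rewrite {1}/a [p in front _ _ _ p]surjective_pairing.
    apply: (@is_derive_top_root (fun z => k + e1 * z) (fun z => e2 * (p.1 + 1))) => //.
    by apply: is_derive_eq; rewrite /GRing.scale /=; ring.
  by have := is_derive1_comp (is_derive_freq _) h; rewrite -surjective_pairing.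
- have h : is_derive p.1 (1 : R) (fun x => front k e1 e2 (x, p.2)) ((a * 0 + e2) / s).
    rewrite {1}/a [p in front _ _ _ p]surjective_pairing.
    apply: (@is_derive_top_root (fun x => k + e1 * p.2) (fun x => e2 * (x + 1))) => //.
    by apply: is_derive_eq; rewrite /GRing.scale /=; ring.
  by have := is_derive1_comp (is_derive_freq _) h; rewrite -surjective_pairing.
- have s0 : s != 0 by rewrite lt0r_neq0// sqrtr_gt0.
  have a0 : a != 0 by rewrite lt0r_neq0.
  have da : 1 + a ^+ 2 != 0 by rewrite lt0r_neq0// ltr_pwDl// sqr_ge0.
  have -> : front_freq k e1 e2 p = a ^+ 2 / (1 + a ^+ 2) by [].
  rewrite /a' {a'}; clearbody a s.
  rewrite !addr0 mulr0 add0r !(exprMn, exprVn) e1E e2E; field.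
  by rewrite a0 s0 da.
Qed.

Lemma front_sign k (e1 e2 : R) p a :
  k + e1 * p.2 - Num.sqrt (discr k e1 e2 p) < 2 -> 1 < a ->
  ((sideq k e1 e2 p a < 0) = (a < front k e1 e2 p)) *
  ((0 < sideq k e1 e2 p a) = (front k e1 e2 p < a)).
Proof. by move=> h a1; apply: quadratic_sign; rewrite -/(discr k e1 e2 p); lra. Qed.

Lemma front_ge k (e1 e2 : R) p : (k + e1 * p.2) / 2 <= front k e1 e2 p.
Proof. by rewrite /front /top_root; have := sqrtr_ge0 (discr k e1 e2 p); rewrite /discr; lra. Qed.

(** If the square root vanished, the front would be b/2 with b = k + e1 z, which the first
    hypothesis puts below 1. *)
Lemma discr_gt0 k (e1 e2 : R) p :
  k + e1 * p.2 - Num.sqrt (discr k e1 e2 p) < 2 -> 1 < front k e1 e2 p ->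
  0 < discr k e1 e2 p.
Proof.
move=> h f1; rewrite -sqrtr_gt0 lt0r sqrtr_ge0 andbT; apply/eqP => s0.
by move: h f1; rewrite /front /top_root -/(discr k e1 e2 p) s0; lra.
Qed.

Lemma sideq_front k (e1 e2 : R) p :
  k + e1 * p.2 - Num.sqrt (discr k e1 e2 p) < 2 -> 1 < front k e1 e2 p ->
  sideq k e1 e2 p (front k e1 e2 p) = 0.
Proof. by move=> h f1; apply: top_root_eq; apply/ltW/discr_gt0. Qed.

(* The smaller root of each of the four quadratics is below [1]: each line sweeps over a point
   of [D] at most once for [a > 1]. *)
Lemma low_root_lt1 p : domD p ->
  [/\ 1 + -1 * p.2 - Num.sqrt (discr 1 (-1) 1 p) < 2,
      3 + 1 * p.2 - Num.sqrt (discr 3 1 (-1) p) < 2,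
      1 + -1 * p.2 - Num.sqrt (discr 1 (-1) (-1) p) < 2 &
      1 + 1 * p.2 - Num.sqrt (discr 1 1 1 p) < 2].
Proof.
case: p => x z [/= /andP[z0 z1] /andP[x0 x1]].
split; try by match goal with |- is_true (_ - Num.sqrt ?d < _) =>
  have := sqrtr_ge0 d end; lra.
(* Only BD is left, where 3 + z exceeds 2. Its discriminant minus (z + 1)^2 is 4(z + 1 - x),
   positive in [D]. *)
rewrite ltrBlDr -ltrBlDl.
have -> : 3 + 1 * z - 2 = Num.sqrt ((z + 1) ^+ 2).
  by rewrite sqrtr_sqr gtr0_norm; lra.
by rewrite /discr ltr_sqrt /=; nra.
Qed.

Lemma Pset_sideq l p : 0 < aof l ->
  Pset l p <-> [/\ sideq 1 (-1) 1 p (aof l) < 0, sideq 3 1 (-1) p (aof l) < 0,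
    0 < sideq 1 (-1) (-1) p (aof l) & 0 < sideq 1 1 1 p (aof l)].
Proof.
rewrite /Pset /= /sideq; move: (aof l) => a a0; case: p => x z /=.
have E1 : a ^+ 2 - (1 + -1 * z) * a - 1 * (x + 1) = a * (z - x / a - (1 - a + a^-1)).
  by field; rewrite lt0r_neq0.
have E2 : a ^+ 2 - (3 + 1 * z) * a - -1 * (x + 1) = a * (a - 3 + a^-1 - (z - x / a)).
  by field; rewrite lt0r_neq0.
have E3 : a ^+ 2 - (1 + -1 * z) * a - -1 * (x + 1) = a * (z + x / a - (1 - a - a^-1)).
  by field; rewrite lt0r_neq0.
have E4 : a ^+ 2 - (1 + 1 * z) * a - 1 * (x + 1) = a * (a - 1 - a^-1 - (z + x / a)).
  by field; rewrite lt0r_neq0.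
rewrite E1 E2 E3 E4 !pmulr_rlt0// !pmulr_rgt0// !subr_lt0 !subr_gt0.
by split=> [[/andP[? ?] /andP[? ?]]|[-> -> -> ->]].
Qed.

End Fronts.

(** * Local form of the stream function and its energy density *)

Section LocalForm.
Context {R : realType}.
Notation mu := (@lebesgue_measure R).
Implicit Types (p q : R * R) (t : R).

Lemma Rintegral_below (g : R -> R) (a b c : R) :
  {within `[a, b], continuous g} -> a <= c <= b ->
  Rintegral mu `[a, b] (fun l => g l * (if l < c then 1 else 0)) =
  Rintegral mu `[a, c] g.
Proof.
move=> cg /andP[ac cb].
have ig : mu.-integrable `[a, b] (EFin \o g).
  by apply: continuous_compact_integrable => //; exact: segment_compact.
(* The strict cut l < c leaves a half-open interval; its missing endpoint is null. *)
rewrite -(@Rintegral_itv_bndo_bndc _ _ c); last first.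
  by apply: integrableS ig => //; apply: subset_itvl; rewrite bnd_simp.
rewrite (_ : (fun _ => _) = g \_ `]-oo, c[); last first.
  apply/funext => l; rewrite /patch mem_setE in_itv /=.
  by case: ifP; rewrite ?mulr1 ?mulr0.
rewrite -Rintegral_mkcondr; congr (Rintegral _ _ _).
apply/seteqP; split=> l /=; rewrite !in_itv /=.
  by case=> /andP[-> _] ->.
by move=> /andP[-> lc]; rewrite lc (le_trans (ltW lc)).
Qed.

Lemma Rintegral_above (g : R -> R) (a b c : R) :
  {within `[a, b], continuous g} -> a <= c <= b ->
  Rintegral mu `[a, b] (fun l => g l * (if c < l then 1 else 0)) =
  Rintegral mu `[a, b] g - Rintegral mu `[a, c] g.
Proof.
move=> cg acb; rewrite -Rintegral_itv_lower//.
move: acb => /andP[ac cb].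
rewrite (_ : (fun _ => _) = g \_ `]c, +oo[); last first.
  apply/funext => l; rewrite /patch mem_setE in_itv /= andbT.
  by case: ifP; rewrite ?mulr1 ?mulr0.
rewrite -Rintegral_mkcondr; congr (Rintegral _ _ _).
apply/seteqP; split=> l /=; rewrite !in_itv /= andbT.
  by case=> /andP[_ ->] ->.
by move=> /andP[cl ->]; rewrite cl (le_trans ac (ltW cl)).
Qed.

Lemma near_vertical p (P : set (R * R)) :
  (\forall q \near p, P q) -> \forall z \near p.2, P (p.1, z).
Proof.
case: p => x z; have := @cvg_pair _ _ _ (nbhs z) (nbhs x) (nbhs z) _ _ _ _ _
  (@cvg_cst _ x _ (nbhs z) _) (@cvg_id _ (nbhs z)).
by apply.
Qed.

Lemma near_horizontal p (P : set (R * R)) :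
  (\forall q \near p, P q) -> \forall x \near p.1, P (x, p.2).
Proof.
case: p => x z; have := @cvg_pair _ _ _ (nbhs x) (nbhs x) (nbhs z) _ _ _ _ _
  (@cvg_id _ (nbhs x)) (@cvg_cst _ z _ (nbhs x) _).
by apply.
Qed.

(** All times share one spatial gradient (k', k), and w^2 stands for the frequency of the moving
    front. The relation between k and k' is the eikonal equation of that front. *)
Definition standing_wave (sigma0 : R -> R) (l1 l2 : R) p : Prop :=
  exists k k' w : R, [/\ w != 0, k' ^+ 2 + k ^+ 2 = k ^+ 2 / w ^+ 2,
    forall t, psi_z sigma0 l1 l2 p t = k * cos (w * t) &
    forall t, psi_x sigma0 l1 l2 p t = k' * cos (w * t)].

(** By the relation between amplitudes, u^2 + w^2 is (k/w)^2 cos^2 (the w on the left being the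
    velocity component), while v, the time integral, gives (k/w)^2 sin^2. *)
Lemma standing_wave_density (sigma0 : R -> R) (l1 l2 : R) p :
  standing_wave sigma0 l1 l2 p -> exists e : R, forall t,
    uU sigma0 l1 l2 p t ^+ 2 + vU sigma0 l1 l2 p t ^+ 2 + wU sigma0 l1 l2 p t ^+ 2 = e.
Proof.
move=> [k [k' [w [w0 kE zE xE]]]]; exists (k ^+ 2 / w ^+ 2) => t.
rewrite /uU /vU /wU zE xE (_ : psi_z _ _ _ _ = fun s => k * cos (w * s)); last exact/funext.
rewrite oint0_cos_mull// !exprMn sqrrN exprMn exprVn.
have -> : k' ^+ 2 = k ^+ 2 / w ^+ 2 - k ^+ 2 by rewrite -kE addrK.
by rewrite [sin _ ^+ 2]sin2cos2; field.
Qed.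

Lemma continuous_mode (sigma0 : R -> R) (l1 l2 t : R) :
  (forall l, l \in `[l1, l2] -> {for l, continuous sigma0}) ->
  {within `[l1, l2], continuous (fun l => cos (Num.sqrt l * t) * sigma0 l)}.
Proof.
move=> cs; apply: continuous_in_subspaceT => l; rewrite mem_setE => l12l.
apply: cvgM; last exact: cs.
apply: continuous_comp; last exact: continuous_cos.
by apply: cvgM; [exact: sqrt_continuous|exact: cvg_cst].
Qed.

(* [F] stands for the position of the only end of the frequency interval that moves with [p];
   the constant [s] is [1] for the upper end and [-1] for the lower one. *)
Lemma moving_end_wave (sigma0 : R -> R) (l1 l2 s : R) (F : R * R -> R) (c : R -> R) p
    (dz dx : R) :
  (forall l, l \in `[l1, l2] -> {for l, continuous sigma0}) ->
  0 < l1 -> l1 < F p < l2 ->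
  is_derive p.2 (1 : R) (fun z => F (p.1, z)) dz ->
  is_derive p.1 (1 : R) (fun x => F (x, p.2)) dx ->
  dx ^+ 2 + dz ^+ 2 = dz ^+ 2 / F p ->
  (\forall q \near p, forall t, psi sigma0 l1 l2 q t =
     c t + s * Rintegral mu `[l1, F q] (fun l => cos (Num.sqrt l * t) * sigma0 l)) ->
  standing_wave sigma0 l1 l2 p.
Proof.
move=> cs l1_gt0 Fp hz hx hg hpsi.
have l12 : l1 < l2 by case/andP: Fp => /lt_trans; apply.
have F0 : 0 < F p by case/andP: Fp => /(lt_trans l1_gt0).
pose g t l := cos (Num.sqrt l * t) * sigma0 l.
have cg t : {within `[l1, l2], continuous (g t)} by exact: continuous_mode.
(* The derivative in the moving end is the integrand at l = F p, times the gradient of [F]. *)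
exists (s * (sigma0 (F p) * dz)), (s * (sigma0 (F p) * dx)), (Num.sqrt (F p)); split.
- by rewrite lt0r_neq0// sqrtr_gt0.
- by rewrite sqr_sqrtr ?ltW// !exprMn -!mulrDr hg !mulrA.
- move=> t; rewrite /psi_z derive1E.
  have hG := derive_Rintegral_upper _ _ _ _ (cg t) Fp.
  rewrite (surjective_pairing p) /= in hG.
  have hc := is_derive1_comp hG hz.
  have h : is_derive p.2 (1 : R) (fun z => c t + s * Rintegral mu `[l1, F (p.1, z)] (g t))
      (s * (g t (F p) * dz)).
    by rewrite [in F p](surjective_pairing p); apply: is_derive_eq; rewrite /GRing.scale /=; ring.
  have hn : \forall z \near p.2, c t + s * Rintegral mu `[l1, F (p.1, z)] (g t) =
      psi sigma0 l1 l2 (p.1, z) t.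
    by apply: filterS (near_vertical _ _ hpsi) => z ->.
  rewrite (@derive_val _ _ _ _ _ _ _ (near_eq_is_derive hn h)) /g; ring.
- move=> t; rewrite /psi_x derive1E.
  have hG := derive_Rintegral_upper _ _ _ _ (cg t) Fp.
  rewrite (surjective_pairing p) /= in hG.
  have hc := is_derive1_comp hG hx.
  have h : is_derive p.1 (1 : R) (fun x => c t + s * Rintegral mu `[l1, F (x, p.2)] (g t))
      (s * (g t (F p) * dx)).
    by rewrite [in F p](surjective_pairing p); apply: is_derive_eq; rewrite /GRing.scale /=; ring.
  have hn : \forall x \near p.1, c t + s * Rintegral mu `[l1, F (x, p.2)] (g t) =
      psi sigma0 l1 l2 (x, p.2) t.
    by apply: filterS (near_horizontal _ _ hpsi) => x ->.
  rewrite (@derive_val _ _ _ _ _ _ _ (near_eq_is_derive hn h)) /g; ring.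
Qed.

Lemma constant_wave (sigma0 : R -> R) (l1 l2 : R) (c : R -> R) p :
  (\forall q \near p, forall t, psi sigma0 l1 l2 q t = c t) ->
  standing_wave sigma0 l1 l2 p.
Proof.
(* Zero amplitudes; the frequency 1 is an arbitrary nonzero choice. *)
move=> hpsi; exists 0, 0, 1; split; rewrite ?oner_neq0//.
- by rewrite expr0n mul0r addr0.
- move=> t; rewrite /psi_z derive1E mul0r.
  rewrite (@near_eq_derive _ _ _ _ (cst (c t))) ?derive_cst//.
  by apply: filterS (near_vertical _ _ hpsi) => z ->.
- move=> t; rewrite /psi_x derive1E mul0r.
  rewrite (@near_eq_derive _ _ _ _ (cst (c t))) ?derive_cst//.
  by apply: filterS (near_horizontal _ _ hpsi) => x ->.
Qed.

End LocalForm.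

(** * The four thresholds at a point of D, and when two can coincide *)

Section Corners.
Context {R : realType}.
Implicit Types (p q : R * R) (a l : R).

Definition fCA p : R := front_freq 1 (-1) 1 p.
Definition fBD p : R := front_freq 3 1 (-1) p.
Definition fAB p : R := front_freq 1 (-1) (-1) p.
Definition fDC p : R := front_freq 1 1 1 p.

Lemma near_domD p : domD p -> \forall q \near p, domD q.
Proof.
case: p => x z [/= /andP[z0 z1] /andP[x0 x1]].
have c1 : (fun q : R * R => q.1) q @[q --> (x, z)] --> x by exact: cvg_fst.
have c2 : (fun q : R * R => q.2) q @[q --> (x, z)] --> z by exact: cvg_snd.
have c3 : (fun q : R * R => q.2 + 1 - q.1) q @[q --> (x, z)] --> z + 1 - x.
  by apply: cvgB => //; apply: cvgD => //; exact: cvg_cst.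
have c3' : \forall q \near (x, z), 0 < q.2 + 1 - q.1.
  by apply: (cvgr_gt _ c3); rewrite subr_gt0.
near=> q; split; apply/andP; split.
- by near: q; exact: (cvgr_gt _ c2 _ z0).
- by near: q; exact: (cvgr_lt _ c2 _ z1).
- by near: q; exact: (cvgr_gt _ c1 _ x0).
- by rewrite -subr_gt0; near: q.
Unshelve. all: by end_near. Qed.

(** With [freq2]: the frequency range from 1/2 to 4/5 is the range 1 < a < 2. *)
Lemma freq1 : freq 1 = 2^-1 :> R.
Proof. by rewrite /freq; field. Qed.

Lemma freq2 : freq 2 = 4 / 5 :> R.
Proof. by rewrite /freq; field. Qed.

(* The last clause makes the larger root the only one above [1]. *)
Definition side_at (k e1 e2 : R) p : Prop :=
  [/\ e1 ^+ 2 = 1, e2 ^+ 2 = 1, 0 <= k + e1 * p.2 &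
      k + e1 * p.2 - Num.sqrt (discr k e1 e2 p) < 2].

Lemma sides_at p : domD p ->
  [/\ side_at 1 (-1) 1 p, side_at 3 1 (-1) p, side_at 1 (-1) (-1) p & side_at 1 1 1 p].
Proof.
move=> Dp; have [? ? ? ?] := low_root_lt1 _ Dp.
case: Dp => /andP[? ?] _.
by split; split; rewrite ?sqrrN ?expr1n//; lra.
Qed.

Lemma side_at_front_ge0 (k e1 e2 : R) p : side_at k e1 e2 p -> 0 <= front k e1 e2 p.
Proof. by case=> _ _ b0 _; have := front_ge k e1 e2 p; lra. Qed.

Lemma side_at_sign (k e1 e2 : R) p l : side_at k e1 e2 p -> 2^-1 < l < 1 ->
  ((sideq k e1 e2 p (aof l) < 0) = (l < front_freq k e1 e2 p)) *
  ((0 < sideq k e1 e2 p (aof l)) = (front_freq k e1 e2 p < l)).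
Proof.
move=> sp /andP[l0 l1].
have a1 : 1 < aof l by apply: aof_gt1; rewrite l0.
have f0 := side_at_front_ge0 _ _ _ _ sp; case: sp => _ _ _ sp.
have l01 : 0 < l < 1 by rewrite l1 andbT; lra.
have a0 : 0 <= aof l by lra.
have E1 : (l < front_freq k e1 e2 p) = (aof l < front k e1 e2 p).
  by rewrite -[l in LHS](freq_aof _ l01) freq_lt.
have E2 : (front_freq k e1 e2 p < l) = (front k e1 e2 p < aof l).
  by rewrite -[l in LHS](freq_aof _ l01) freq_lt.
by rewrite E1 E2; exact: front_sign.
Qed.

Lemma side_at_mid (k e1 e2 : R) p : side_at k e1 e2 p ->
  2^-1 < front_freq k e1 e2 p < 4 / 5 ->
  [/\ 1 < front k e1 e2 p < 2, aof (front_freq k e1 e2 p) = front k e1 e2 p,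
      sideq k e1 e2 p (front k e1 e2 p) = 0 & 0 < discr k e1 e2 p].
Proof.
move=> sp; have f0 := side_at_front_ge0 _ _ _ _ sp.
rewrite -freq1 -freq2 /front_freq !freq_lt// => f12.
have /andP[f1 _] := f12; case: sp => _ _ _ sp.
split=> //; first by rewrite aof_freq.
  exact: sideq_front.
exact: discr_gt0.
Qed.

Lemma chi_fronts p l : domD p -> 2^-1 < l < 1 ->
  chi p l = if [&& l < fCA p, l < fBD p, fAB p < l & fDC p < l] then 1 else 0.
Proof.
move=> Dp l01; have [s1 s2 s3 s4] := sides_at _ Dp.
have a0 : 0 < aof l by rewrite (lt_trans ltr01)// aof_gt1.
rewrite /chi; congr (if _ then _ else _).
have E : (Pset l `&` @domD R) p <-> [&& l < fCA p, l < fBD p, fAB p < l & fDC p < l].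
  rewrite /fCA /fBD /fAB /fDC -!side_at_sign//; split.
    by case=> /(Pset_sideq _ _ a0)[-> -> -> ->].
  by move=> /and4P[? ? ? ?]; split=> //; apply/(Pset_sideq _ _ a0).
by apply/idP/idP => [/asboolP/E|/E/asboolP].
Qed.

(* Two sides of the same [P] meet only at the vertices, which lie on the boundary of [D],
   or (opposite sides) never. *)
Lemma sideq_inj p a : domD p -> 1 < a < 2 ->
  [/\ (sideq 1 (-1) 1 p a = 0 -> sideq 3 1 (-1) p a <> 0),
      (sideq 1 (-1) (-1) p a = 0 -> sideq 1 1 1 p a <> 0),
      (sideq 1 (-1) 1 p a = 0 -> sideq 1 (-1) (-1) p a <> 0) &
      (sideq 1 (-1) 1 p a = 0 -> sideq 1 1 1 p a <> 0)] /\
  (sideq 3 1 (-1) p a = 0 -> sideq 1 (-1) (-1) p a <> 0) /\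
  (sideq 3 1 (-1) p a = 0 -> sideq 1 1 1 p a <> 0).
Proof.
case: p => x z [/= /andP[z0 z1] /andP[x0 x1]] /andP[a1 a2]; rewrite /sideq /=.
(* For opposite sides the two equations add up to a multiple of a(2 - a) or a(a - 1), nonzero here.
   For adjacent ones their difference forces x = -1, z = 0 or z = -1, except for BD and DC. *)
split; first split.
- move=> h1 h2; have : a * (2 - a) = 0 by lra.
  by apply/eqP; rewrite lt0r_neq0// mulr_gt0; lra.
- move=> h1 h2; have : a * (a - 1) = 0 by lra.
  by apply/eqP; rewrite lt0r_neq0// mulr_gt0; lra.
- by move=> h1 h2; lra.
- move=> h1 h2; have : a * - z = 0 by lra.
  by apply/eqP; rewrite lt0r_neq0// mulr_gt0; lra.
split=> h1 h2.
- have : a * (1 + z) = 0 by lra.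
  by apply/eqP; rewrite lt0r_neq0// mulr_gt0; lra.
(* For BD and DC the difference only fixes a; putting it back gives the slanted edge x = z + 1. *)
- have xE : a = x + 1 by lra.
  have : a * (z + 1 - x) = 0 by move: h1; rewrite xE; lra.
  by apply/eqP; rewrite lt0r_neq0// mulr_gt0; lra.
Qed.

(** Equal frequencies in the range would give both quadratics the same root a between 1 and 2. *)
Lemma fronts_neq (k e1 e2 k' e1' e2' : R) p :
  side_at k e1 e2 p -> side_at k' e1' e2' p ->
  (forall a, 1 < a < 2 -> sideq k e1 e2 p a = 0 -> sideq k' e1' e2' p a <> 0) ->
  2^-1 < front_freq k e1 e2 p < 4 / 5 ->
  front_freq k e1 e2 p != front_freq k' e1' e2' p.
Proof.
move=> s s' h m; apply/eqP => e.
have [a12 aE q0 _] := side_at_mid _ _ _ _ s m.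
have m' : 2^-1 < front_freq k' e1' e2' p < 4 / 5 by rewrite -e.
have [_ aE' q0' _] := side_at_mid _ _ _ _ s' m'.
by apply: (h _ a12 q0); rewrite -aE e aE' q0'.
Qed.

(** Boundary points of [Pset] will be approached vertically from inside; the sign of [s] selects up
    or down. *)
Lemma closure_vertical (E : set (R * R)) p (s : R) :
  (\forall d \near 0^'+, E (p.1, p.2 + s * d)) -> closure E p.
Proof.
move=> nE B nB.
have c : (p.1, p.2 + s * d) @[d --> (0 : R)^'+] --> p.
  apply: cvg_at_right_filter.
  have h : p.2 + s * d @[d --> (0 : R)] --> p.2.
    have c : continuous (fun d : R => p.2 + s * d).
      move=> d; apply: cvgD; first exact: cvg_cst.
      by apply: cvgM; [exact: cvg_cst|exact: cvg_id].
    by have := c 0; rewrite /continuous_at mulr0 addr0.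
  rewrite [X in _ --> X](surjective_pairing p).
  exact: (@cvg_pair _ _ _ _ (nbhs p.1) (nbhs p.2) _ _ _ _ _
    (@cvg_cst _ p.1 _ (nbhs (0 : R)) _) h).
have nB' := c _ nB.
near (0 : R)^'+ => d.
exists (p.1, p.2 + s * d); split; first by near: d.
by near: d.
Unshelve. all: by end_near. Qed.

End Corners.

(** * Points on the swept strips, from comparisons of thresholds *)

Section Sides.
Context {R : realType}.
Implicit Types (p q : R * R) (a l : R).

Lemma near_affine_lt0 (x y : R) : x < 0 \/ x = 0 /\ y < 0 ->
  \forall d \near 0^'+, x + d * y < 0.
Proof.
case=> [x0|[-> y0]]; last first.
  by apply: filterS (nbhs_right_gt 0) => d d0; rewrite add0r pmulr_rlt0.
have c : x + d * y @[d --> (0 : R)^'+] --> x.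
  apply: cvg_at_right_filter.
  have c : continuous (fun d : R => x + d * y).
    move=> d; apply: cvgD; first exact: cvg_cst.
    by apply: cvgM; [exact: cvg_id|exact: cvg_cst].
  by have := c 0; rewrite /continuous_at mul0r addr0.
exact: (cvgr_lt _ c).
Qed.

(** [sideq] is affine in z: a vertical shift by s d changes it by - e1 s a d. A vanishing side
    condition thus becomes strict for the right sign of [s], and strict ones persist for small d. *)
Lemma closure_Pset p l (s : R) : 0 < aof l ->
  (sideq 1 (-1) 1 p (aof l) < 0 \/ sideq 1 (-1) 1 p (aof l) = 0 /\ s < 0) ->
  (sideq 3 1 (-1) p (aof l) < 0 \/ sideq 3 1 (-1) p (aof l) = 0 /\ 0 < s) ->
  (0 < sideq 1 (-1) (-1) p (aof l) \/ sideq 1 (-1) (-1) p (aof l) = 0 /\ 0 < s) ->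
  (0 < sideq 1 1 1 p (aof l) \/ sideq 1 1 1 p (aof l) = 0 /\ s < 0) ->
  closure (Pset l) p.
Proof.
move=> a0 h1 h2 h3 h4; apply: (@closure_vertical R _ _ s).
have sa x : (x < 0 -> x * aof l < 0) /\ (0 < x -> 0 < x * aof l).
  by rewrite pmulr_llt0// pmulr_lgt0.
have n1 : \forall d \near 0^'+, sideq 1 (-1) 1 p (aof l) + d * (s * aof l) < 0.
  by apply: near_affine_lt0; case: h1 => [|[-> /(sa _).1]]; [left|right].
have n2 : \forall d \near 0^'+, sideq 3 1 (-1) p (aof l) + d * (- s * aof l) < 0.
  apply: near_affine_lt0; case: h2 => [|[-> s0]]; [by left|right; split=> //].
  by apply: (sa _).1; rewrite oppr_lt0.
have n3 : \forall d \near 0^'+, - sideq 1 (-1) (-1) p (aof l) + d * (- s * aof l) < 0.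
  apply: near_affine_lt0; case: h3 => [|[-> s0]]; [by left; rewrite oppr_lt0|right].
  by split; [exact: oppr0|apply: (sa _).1; rewrite oppr_lt0].
have n4 : \forall d \near 0^'+, - sideq 1 1 1 p (aof l) + d * (s * aof l) < 0.
  apply: near_affine_lt0; case: h4 => [|[-> s0]]; [by left; rewrite oppr_lt0|right].
  by split; [exact: oppr0|exact: (sa _).1].
near=> d; apply/Pset_sideq => //.
have m1 : sideq 1 (-1) 1 p (aof l) + d * (s * aof l) < 0 by near: d.
have m2 : sideq 3 1 (-1) p (aof l) + d * (- s * aof l) < 0 by near: d.
have m3 : - sideq 1 (-1) (-1) p (aof l) + d * (- s * aof l) < 0 by near: d.
have m4 : - sideq 1 1 1 p (aof l) + d * (s * aof l) < 0 by near: d.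
by move: m1 m2 m3 m4; rewrite /sideq /=; split; lra.
Unshelve. all: by end_near. Qed.

Lemma aof_gt0 l : 2^-1 < l < 1 -> 0 < aof l.
Proof. by move=> h; rewrite (lt_trans ltr01)// aof_gt1. Qed.

Section Members.
Context (l1 l2 : R) (q : R * R) (l1_gt : 2^-1 < l1) (l2_lt : l2 < 4 / 5) (Dq : domD q).

Let mid l : l1 <= l <= l2 -> (2^-1 < l < 4 / 5) /\ (2^-1 < l < 1).
Proof.
move=> /andP[l1l ll2]; have h1 := lt_le_trans l1_gt l1l; have h2 := le_lt_trans ll2 l2_lt.
by split; apply/andP; split=> //; lra.
Qed.

(** Here and in the next three lemmas, the side is taken at the frequency where its line passes
    through [q]; the strict comparisons put [q] strictly on the inner side of the other three
    lines. *)
Lemma SigmaCA_mem : l1 <= fCA q <= l2 ->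
  fCA q < fBD q -> fAB q < fCA q -> fDC q < fCA q -> Sigma (@sideCA R) l1 l2 q.
Proof.
move=> l12 h1 h2 h3; exists (fCA q); first by rewrite /= in_itv.
have [m45 m1] := mid _ l12; have [s1 s2 s3 s4] := sides_at _ Dq.
have [_ aE q0 _] := side_at_mid _ _ _ _ s1 m45; rewrite -aE -/(fCA q) in q0.
have a0 := aof_gt0 _ m1; split.
  (* [P] lies below CA and DC and above BD and AB, hence the direction -1 for the former and 1 for
     the latter. *)
  by apply: (@closure_Pset _ _ (-1)) => //; [right; split=> //; lra|left..];
    rewrite side_at_sign.
rewrite /=; move: q0; rewrite /sideq; move: (aof _) a0 => a a0 q0.
apply: (mulfI (lt0r_neq0 a0)); rewrite !(mulrDr, mulrN) mulrCA !divff ?lt0r_neq0//; lra.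
Qed.

Lemma SigmaBD_mem : l1 <= fBD q <= l2 ->
  fBD q < fCA q -> fAB q < fBD q -> fDC q < fBD q -> Sigma (@sideBD R) l1 l2 q.
Proof.
move=> l12 h1 h2 h3; exists (fBD q); first by rewrite /= in_itv.
have [m45 m1] := mid _ l12; have [s1 s2 s3 s4] := sides_at _ Dq.
have [_ aE q0 _] := side_at_mid _ _ _ _ s2 m45; rewrite -aE -/(fBD q) in q0.
have a0 := aof_gt0 _ m1; split.
  by apply: (@closure_Pset _ _ 1) => //; [left|right; split=> //; lra|left..];
    rewrite side_at_sign.
rewrite /=; move: q0; rewrite /sideq; move: (aof _) a0 => a a0 q0.
apply: (mulfI (lt0r_neq0 a0)); rewrite !(mulrDr, mulrN) mulrCA !divff ?lt0r_neq0//; lra.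
Qed.

Lemma SigmaAB_mem : l1 <= fAB q <= l2 ->
  fAB q < fCA q -> fAB q < fBD q -> fDC q < fAB q -> Sigma (@sideAB R) l1 l2 q.
Proof.
move=> l12 h1 h2 h3; exists (fAB q); first by rewrite /= in_itv.
have [m45 m1] := mid _ l12; have [s1 s2 s3 s4] := sides_at _ Dq.
have [_ aE q0 _] := side_at_mid _ _ _ _ s3 m45; rewrite -aE -/(fAB q) in q0.
have a0 := aof_gt0 _ m1; split.
  by apply: (@closure_Pset _ _ 1) => //; [left|left|right; split=> //; lra|left];
    rewrite side_at_sign.
rewrite /=; move: q0; rewrite /sideq; move: (aof _) a0 => a a0 q0.
apply: (mulfI (lt0r_neq0 a0)); rewrite !(mulrDr, mulrN) mulrCA !divff ?lt0r_neq0//; lra.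
Qed.

Lemma SigmaDC_mem : l1 <= fDC q <= l2 ->
  fDC q < fCA q -> fDC q < fBD q -> fAB q < fDC q -> Sigma (@sideDC R) l1 l2 q.
Proof.
move=> l12 h1 h2 h3; exists (fDC q); first by rewrite /= in_itv.
have [m45 m1] := mid _ l12; have [s1 s2 s3 s4] := sides_at _ Dq.
have [_ aE q0 _] := side_at_mid _ _ _ _ s4 m45; rewrite -aE -/(fDC q) in q0.
have a0 := aof_gt0 _ m1; split.
  by apply: (@closure_Pset _ _ (-1)) => //; [left|left|left|right; split=> //; lra];
    rewrite side_at_sign.
rewrite /=; move: q0; rewrite /sideq; move: (aof _) a0 => a a0 q0.
apply: (mulfI (lt0r_neq0 a0)); rewrite !(mulrDr, mulrN) mulrCA !divff ?lt0r_neq0//; lra.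
Qed.

End Members.
End Sides.

(** * Which thresholds bind near a point, and the resulting wave *)

Section Dichotomy.
Context {R : realType}.
Implicit Types (p q : R * R) (f g F G : R * R -> R).

Lemma near_lt f g p : {for p, continuous f} -> {for p, continuous g} ->
  f p < g p -> \forall q \near p, f q < g q.
Proof.
move=> cf cg fg.
have c : (fun q => g q - f q) q @[q --> p] --> g p - f p by apply: cvgB.
have : \forall q \near p, 0 < g q - f q by apply: (cvgr_gt _ c); rewrite subr_gt0.
by apply: filterS => q; rewrite subr_gt0.
Qed.

Lemma near_gt_cst f p (c : R) : {for p, continuous f} -> c < f p ->
  \forall q \near p, c < f q.
Proof. by move=> cf; apply: (near_lt (cst c) f) => //; exact: cvg_cst. Qed.

Lemma near_lt_cst f p (c : R) : {for p, continuous f} -> f p < c ->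
  \forall q \near p, f q < c.
Proof. by move=> cf; apply: (near_lt f (cst c)) => //; exact: cvg_cst. Qed.

(** Of two upper thresholds, [f] alone decides near [p]. Only l in [l1, l2] is tested, so that [f]
    and [g] may coincide outside that range; inside it, the strict inequality is what places nearby
    points on a side. *)
Definition binds_above (l1 l2 : R) p f g : Prop :=
  (l1 < f p < l2 -> f p < g p) /\
  \forall q \near p, forall l, l1 <= l <= l2 -> (l < f q) && (l < g q) = (l < f q).

Definition binds_below (l1 l2 : R) p f g : Prop :=
  (l1 < f p < l2 -> g p < f p) /\
  \forall q \near p, forall l, l1 <= l <= l2 -> (f q < l) && (g q < l) = (f q < l).

Lemma binds_above_total (l1 l2 : R) p f g :
  {for p, continuous f} -> {for p, continuous g} ->
  f p != l1 -> f p != l2 -> (l1 < f p < l2 -> f p != g p) ->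
  binds_above l1 l2 p f g \/ binds_above l1 l2 p g f.
Proof.
move=> cf cg f1 f2 fg; case: (ltgtP (f p) (g p)) => [lt|lt|e].
- left; split=> //; apply: filterS (near_lt _ _ _ cf cg lt) => q fgq l _.
  by case: ltP => //= lf; rewrite (lt_trans lf).
- right; split=> //; apply: filterS (near_lt _ _ _ cg cf lt) => q fgq l _.
  by case: (ltP l (g q)) => //= lf; rewrite (lt_trans lf).
(* Equal thresholds lie outside [l1, l2], so near [p] both comparisons have a constant truth value
   over the range. *)
left; split=> [/fg|]; first by rewrite e eqxx.
case: (ltgtP (f p) l1) f1 => // [lt _|gt _].
  apply: filterS (near_lt_cst _ _ _ cf lt) => q fq l /andP[l1l _].
  by rewrite ltNge (le_trans (ltW fq) l1l).
case: (ltgtP (f p) l2) f2 => // [lt _|gt2 _].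
  by have := fg; rewrite gt lt e eqxx => /(_ isT).
have gl2 : l2 < g p by rewrite -e.
near=> q => l /andP[_ ll2].
have h1 : l2 < f q by near: q; exact: near_gt_cst.
have h2 : l2 < g q by near: q; exact: near_gt_cst.
by rewrite (le_lt_trans ll2 h1) (le_lt_trans ll2 h2).
Unshelve. all: by end_near. Qed.

Lemma binds_below_total (l1 l2 : R) p f g :
  {for p, continuous f} -> {for p, continuous g} ->
  f p != l1 -> f p != l2 -> (l1 < f p < l2 -> f p != g p) ->
  binds_below l1 l2 p f g \/ binds_below l1 l2 p g f.
Proof.
move=> cf cg f1 f2 fg; case: (ltgtP (f p) (g p)) => [lt|lt|e].
- right; split=> //; apply: filterS (near_lt _ _ _ cf cg lt) => q fgq l _.
  by case: (ltP (g q) l) => //= lf; rewrite (lt_trans fgq).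
- left; split=> //; apply: filterS (near_lt _ _ _ cg cf lt) => q fgq l _.
  by case: (ltP (f q) l) => //= lf; rewrite (lt_trans fgq).
left; split=> [/fg|]; first by rewrite e eqxx.
case: (ltgtP (f p) l2) f2 => // [lt _|gt _]; last first.
  apply: filterS (near_gt_cst _ _ _ cf gt) => q fq l /andP[_ ll2].
  by rewrite ltNge (le_trans ll2 (ltW fq)).
case: (ltgtP (f p) l1) f1 => // [lt2 _|gt2 _]; last first.
  by have := fg; rewrite gt2 lt e eqxx => /(_ isT).
have gl1 : g p < l1 by rewrite -e.
near=> q => l /andP[l1l _].
have h1 : f q < l1 by near: q; exact: near_lt_cst.
have h2 : g q < l1 by near: q; exact: near_lt_cst.
by rewrite (lt_le_trans h1 l1l) (lt_le_trans h2 l1l).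
Unshelve. all: by end_near. Qed.

Lemma psi_eq_Rintegral (sigma0 : R -> R) (l1 l2 : R) q t (b : R -> R) :
  (forall l, l1 <= l <= l2 -> chi q l = b l) ->
  psi sigma0 l1 l2 q t = Rintegral (@lebesgue_measure R) `[l1, l2]
    (fun l => cos (Num.sqrt l * t) * sigma0 l * b l).
Proof.
move=> qb; apply: eq_Rintegral => l; rewrite mem_setE in_itv /= => l12.
by rewrite qb.
Qed.

(** Cases on where [F] and [G] lie relative to [l1, l2]: the interval of active frequencies is
    locally empty, locally everything, or has one moving end. Two moving ends are excluded unless
    the interval is empty. *)
Lemma front_wave (sigma0 : R -> R) (l1 l2 : R) F G p :
  2^-1 < l1 -> l1 < l2 -> l2 < 4 / 5 ->
  (forall l, l \in `[l1, l2] -> {for l, continuous sigma0}) ->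
  {for p, continuous F} -> {for p, continuous G} ->
  F p != l1 -> F p != l2 -> G p != l1 -> G p != l2 ->
  (forall H, H = F \/ H = G -> l1 < H p < l2 -> exists dz dx : R,
    [/\ is_derive p.2 (1 : R) (fun z => H (p.1, z)) dz,
        is_derive p.1 (1 : R) (fun x => H (x, p.2)) dx &
        dx ^+ 2 + dz ^+ 2 = dz ^+ 2 / H p]) ->
  ~ (l1 < F p < l2 /\ l1 < G p < l2 /\ G p <= F p) ->
  (\forall q \near p, forall l, l1 <= l <= l2 ->
     chi q l = if (l < F q) && (G q < l) then 1 else 0) ->
  standing_wave sigma0 l1 l2 p.
Proof.
move=> l1_gt l12 l2_lt cs cF cG F1 F2 G1 G2 reg notboth nchi.
have l1_gt0 : 0 < l1 by lra.
have const b : (\forall q \near p, forall l, l1 <= l <= l2 -> chi q l = b l) ->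
    standing_wave sigma0 l1 l2 p.
  move=> nb; apply: (@constant_wave R sigma0 l1 l2 (fun t => Rintegral lebesgue_measure `[l1, l2]
    (fun l => cos (Num.sqrt l * t) * sigma0 l * b l))).
  by apply: filterS nb => q qb t; exact: psi_eq_Rintegral.
have cg t : {within `[l1, l2], continuous (fun l => cos (Num.sqrt l * t) * sigma0 l)}.
  exact: continuous_mode.
case: (ltgtP (F p) l1) F1 => // [Fl1 _|l1F _].
  apply: (const (fun=> 0)); near=> q => l l12l.
  have -> : chi q l = if (l < F q) && (G q < l) then 1 else 0 by move: l l12l; near: q.
  have Fq : F q < l1 by near: q; exact: near_lt_cst.
  by case/andP: l12l => l1l _; rewrite ltNge (le_trans (ltW Fq) l1l).
case: (ltgtP (G p) l2) G2 => // [Gl2 _|l2G _]; last first.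
  apply: (const (fun=> 0)); near=> q => l l12l.
  have -> : chi q l = if (l < F q) && (G q < l) then 1 else 0 by move: l l12l; near: q.
  have Gq : l2 < G q by near: q; exact: near_gt_cst.
  by case/andP: l12l => _ ll2; rewrite [G q < l]ltNge (le_trans ll2 (ltW Gq)) andbF.
case: (ltgtP (F p) l2) F2 => // [Fl2 _|l2F _];
  case: (ltgtP (G p) l1) G1 => // [Gl1 _|l1G _].
(* The upper end moves; the lower threshold is below the range. *)
- have [dz [dx [hz hx hg]]] : exists dz dx : R,
    [/\ is_derive p.2 (1 : R) (fun z => F (p.1, z)) dz,
        is_derive p.1 (1 : R) (fun x => F (x, p.2)) dx &
        dx ^+ 2 + dz ^+ 2 = dz ^+ 2 / F p].
    by apply: reg; [left|rewrite l1F].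
  apply: (@moving_end_wave R sigma0 l1 l2 1 F (fun=> 0) p dz dx) => //; first by rewrite l1F.
  near=> q => t; rewrite add0r mul1r -(Rintegral_below _ _ l2)//; last first.
    by apply/andP; split; apply/ltW; near: q; [exact: near_gt_cst|exact: near_lt_cst].
  apply: psi_eq_Rintegral => l l12l.
  have -> : chi q l = if (l < F q) && (G q < l) then 1 else 0 by move: l l12l; near: q.
  have Gq : G q < l1 by near: q; exact: near_lt_cst.
  by case/andP: l12l => l1l _; rewrite (lt_le_trans Gq l1l) andbT.
(* Both thresholds are in the range: either the excluded corner, or [F] below [G] and an empty
   interval. *)
- case: (leP (G p) (F p)) => GF; first by case: notboth; rewrite l1F Fl2 l1G Gl2 GF.
  apply: (const (fun=> 0)); near=> q => l l12l.
  have -> : chi q l = if (l < F q) && (G q < l) then 1 else 0 by move: l l12l; near: q.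
  have FGq : F q < G q by near: q; exact: near_lt.
  by case: (ltP l (F q)) => //= lF; rewrite ltNge (ltW (lt_trans lF FGq)).
- apply: (const (fun=> 1)); near=> q => l l12l.
  have -> : chi q l = if (l < F q) && (G q < l) then 1 else 0 by move: l l12l; near: q.
  have Fq : l2 < F q by near: q; exact: near_gt_cst.
  have Gq : G q < l1 by near: q; exact: near_lt_cst.
  by case/andP: l12l => l1l ll2; rewrite (le_lt_trans ll2 Fq) (lt_le_trans Gq l1l).
(* The lower end moves: the full integral minus the part below [G]. *)
- have [dz [dx [hz hx hg]]] : exists dz dx : R,
    [/\ is_derive p.2 (1 : R) (fun z => G (p.1, z)) dz,
        is_derive p.1 (1 : R) (fun x => G (x, p.2)) dx &
        dx ^+ 2 + dz ^+ 2 = dz ^+ 2 / G p].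
    by apply: reg; [right|rewrite l1G].
  apply: (@moving_end_wave R sigma0 l1 l2 (-1) G (fun t => Rintegral lebesgue_measure `[l1, l2]
    (fun l => cos (Num.sqrt l * t) * sigma0 l)) p dz dx) => //; first by rewrite l1G.
  near=> q => t; rewrite mulN1r -Rintegral_above//; last first.
    by apply/andP; split; apply/ltW; near: q; [exact: near_gt_cst|exact: near_lt_cst].
  apply: psi_eq_Rintegral => l l12l.
  have -> : chi q l = if (l < F q) && (G q < l) then 1 else 0 by move: l l12l; near: q.
  have Fq : l2 < F q by near: q; exact: near_gt_cst.
  by case/andP: l12l => _ ll2; rewrite (le_lt_trans ll2 Fq).
Unshelve. all: by end_near. Qed.

End Dichotomy.

(** * Standing waves in Omega0 off the eight lines, and conservation of energy *)

Section Main.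
Context {R : realType}.
Implicit Types (p q : R * R).

(** The equation [sideq] = 0 at a = [aof l], regrouped as an affine equation in x and z. *)
Definition side_line (k e1 e2 l : R) : set (R * R) :=
  line (- e2) (- (e1 * aof l)) (aof l ^+ 2 - k * aof l - e2).

(** Contains the points of [D] where a threshold equals [l]. For [l] an end of the frequency range,
    a moving end enters or leaves the range there, and the stream function may have a kink. *)
Definition extreme_lines (l : R) : set (R * R) :=
  side_line 1 (-1) 1 l `|` side_line 3 1 (-1) l `|`
  side_line 1 (-1) (-1) l `|` side_line 1 1 1 l.

Lemma side_lineP (k e1 e2 l : R) p : side_at k e1 e2 p -> 2^-1 < l < 4 / 5 ->
  front_freq k e1 e2 p = l -> side_line k e1 e2 l p.
Proof.
move=> s m e; rewrite -e in m *.
have [_ aE + _] := side_at_mid _ _ _ _ s m.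
by rewrite -aE /side_line /line /sideq /=; lra.
Qed.

Lemma extreme_lines_null (l : R) : 2^-1 < l < 4 / 5 ->
  measurable (extreme_lines l : set (measurableTypeR R * measurableTypeR R)) /\
  ((@lebesgue_measure R) \x (@lebesgue_measure R))%E (extreme_lines l) = 0%E.
Proof.
move=> /andP[l1 l2].
have a0 : aof l != 0 by rewrite lt0r_neq0// aof_gt0// l1; lra.
have m (k e1 e2 : R) := measurable_line (- e2) (- (e1 * aof l)) (aof l ^+ 2 - k * aof l - e2).
have z (k e1 e2 : R) : e1 != 0 ->
    ((@lebesgue_measure R) \x (@lebesgue_measure R))%E (side_line k e1 e2 l) = 0%E.
  by move=> e0; apply: line_null; rewrite oppr_eq0 mulf_neq0.
split; first by do 3 (apply: measurableU; last exact: m); exact: m.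
have N1 : -1 != 0 :> R by rewrite oppr_eq0 oner_eq0.
rewrite !measureU0 ?z ?oner_eq0//; by [repeat (apply: measurableU || exact: m)|exact: z].
Qed.

Lemma Omega0_standing_wave (sigma0 : R -> R) (l1 l2 : R) p :
  2^-1 < l1 -> l1 < l2 -> l2 < 4 / 5 ->
  (forall l, l \in `[l1, l2] -> {for l, continuous sigma0}) ->
  Omega0 l1 l2 p -> ~ extreme_lines l1 p -> ~ extreme_lines l2 p ->
  standing_wave sigma0 l1 l2 p.
Proof.
move=> l1_gt l12 l2_lt cs Op N1 N2.
have [Dp noD] := interior_subset Op.
have [s1 s2 s3 s4] := sides_at _ Dp.
have m1 : 2^-1 < l1 < 4 / 5 by rewrite l1_gt (lt_trans l12).
have m2 : 2^-1 < l2 < 4 / 5 by rewrite l2_lt (lt_trans l1_gt).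
have ne (k e1 e2 : R) (s : side_at k e1 e2 p) :
    (side_line k e1 e2 l1 p -> extreme_lines l1 p) ->
    (side_line k e1 e2 l2 p -> extreme_lines l2 p) ->
    front_freq k e1 e2 p != l1 /\ front_freq k e1 e2 p != l2.
  move=> i1 i2; split; apply/eqP => e.
    by apply: N1; apply: i1; exact: side_lineP e.
  by apply: N2; apply: i2; exact: side_lineP e.
have [CA1 CA2] : fCA p != l1 /\ fCA p != l2 by apply: ne => // h; left; left; left.
have [BD1 BD2] : fBD p != l1 /\ fBD p != l2 by apply: ne => // h; left; left; right.
have [AB1 AB2] : fAB p != l1 /\ fAB p != l2 by apply: ne => // h; left; right.
have [DC1 DC2] : fDC p != l1 /\ fDC p != l2 by apply: ne => // h; right.
have mid (x : R) : l1 < x < l2 -> 2^-1 < x < 4 / 5.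
  by case/andP => a b; rewrite (lt_trans l1_gt a) (lt_trans b l2_lt).
have reg (k e1 e2 : R) : side_at k e1 e2 p -> l1 < front_freq k e1 e2 p < l2 ->
    exists dz dx : R,
    [/\ is_derive p.2 (1 : R) (fun z => front_freq k e1 e2 (p.1, z)) dz,
        is_derive p.1 (1 : R) (fun x => front_freq k e1 e2 (x, p.2)) dx &
        dx ^+ 2 + dz ^+ 2 = dz ^+ 2 / front_freq k e1 e2 p].
  move=> s /mid m; have [/andP[f1 _] _ _ d0] := side_at_mid _ _ _ _ s m.
  case: s => e1E e2E _ _; apply: front_freq_gradient => //.
  exact: lt_trans f1.
have cCA : {for p, continuous fCA} by exact: continuous_front_freq.
have cBD : {for p, continuous fBD} by exact: continuous_front_freq.
have cAB : {for p, continuous fAB} by exact: continuous_front_freq.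
have cDC : {for p, continuous fDC} by exact: continuous_front_freq.
have inj := fun a => @sideq_inj R p a Dp.
have dCABD : l1 < fCA p < l2 -> fCA p != fBD p.
  by move/mid; apply: fronts_neq => // a /inj[[]].
have dABDC : l1 < fAB p < l2 -> fAB p != fDC p.
  by move/mid; apply: fronts_neq => // a /inj[[]].
have dCAAB : l1 < fCA p < l2 -> fCA p != fAB p.
  by move/mid; apply: fronts_neq => // a /inj[[]].
have dCADC : l1 < fCA p < l2 -> fCA p != fDC p.
  by move/mid; apply: fronts_neq => // a /inj[[]].
have dBDAB : l1 < fBD p < l2 -> fBD p != fAB p.
  by move/mid; apply: fronts_neq => // a /inj[_ []].
have dBDDC : l1 < fBD p < l2 -> fBD p != fDC p.
  by move/mid; apply: fronts_neq => // a /inj[_ []].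
(* Two binding ends strictly inside the range keep their strict order near [p], so a whole
   neighbourhood lies on both swept strips. *)
have corner (F F' G G' : R * R -> R) :
    {for p, continuous F} -> {for p, continuous F'} ->
    {for p, continuous G} -> {for p, continuous G'} ->
    binds_above l1 l2 p F F' -> binds_below l1 l2 p G G' ->
    (l1 < F p < l2 -> F p != G p) ->
    l1 < F p < l2 /\ l1 < G p < l2 /\ G p <= F p ->
    \forall q \near p, [/\ domD q, l1 <= F q <= l2, l1 <= G q <= l2 &
      [/\ F q < F' q, G' q < G q & G q < F q]].
  move=> cF cF' cG cG' [bF _] [bG _] neq [mF [mG GF]].
  have FF' := bF mF; have GG' := bG mG.
  have {}GF : G p < F p by rewrite lt_neqAle eq_sym neq.
  case/andP: mF => F1 F2; case/andP: mG => G1 G2.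
  near=> q; split.
  - by near: q; exact: near_domD.
  - by apply/andP; split; apply/ltW; near: q; [exact: near_gt_cst|exact: near_lt_cst].
  - by apply/andP; split; apply/ltW; near: q; [exact: near_gt_cst|exact: near_lt_cst].
  - by split; near: q; exact: near_lt.
have nchi : \forall q \near p, forall l, l1 <= l <= l2 ->
    chi q l = if ((l < fCA q) && (l < fBD q)) && ((fAB q < l) && (fDC q < l)) then 1 else 0.
  apply: filterS (near_domD _ Dp) => q Dq l /andP[l1l ll2].
  have l01 : 2^-1 < l < 1.
    rewrite (lt_le_trans l1_gt l1l) (le_lt_trans ll2)// (lt_trans l2_lt)//.
    by rewrite ltr_pdivrMr// mul1r ltr_nat.
  by rewrite (chi_fronts _ _ Dq l01) !andbA.
have chi_bind (F F' G G' : R * R -> R) :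
    binds_above l1 l2 p F F' -> binds_below l1 l2 p G G' ->
    (forall q l, ((l < fCA q) && (l < fBD q)) && ((fAB q < l) && (fDC q < l)) =
       ((l < F q) && (l < F' q)) && ((G q < l) && (G' q < l))) ->
    \forall q \near p, forall l, l1 <= l <= l2 ->
      chi q l = if (l < F q) && (G q < l) then 1 else 0.
  move=> [_ nF] [_ nG] e.
  near=> q => l l12l.
  have -> : chi q l = if ((l < fCA q) && (l < fBD q)) && ((fAB q < l) && (fDC q < l))
      then 1 else 0 by move: l l12l; near: q.
  rewrite e.
  have -> : (l < F q) && (l < F' q) = (l < F q) by move: l l12l; near: q.
  by have -> : (G q < l) && (G' q < l) = (G q < l) by move: l l12l; near: q.
(* The binding upper side is CA or BD, the binding lower one AB or DC. Each pair is adjacent and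
   meets in one corner region: [D2], [D1], [D3], [D4] in the order of the cases. *)
have [ba|ba] := binds_above_total _ _ _ _ _ cCA cBD CA1 CA2 dCABD;
have [bb|bb] := binds_below_total _ _ _ _ _ cAB cDC AB1 AB2 dABDC.
- apply: (@front_wave R sigma0 l1 l2 fCA fAB p) => //.
  + by move=> H [->|->]; exact: reg.
  + move=> h; apply: noD; left; left; right.
    apply: filterS (corner _ _ _ _ cCA cBD cAB cDC ba bb dCAAB h).
    move=> q [Dq a b [c d e]]; split.
      by apply: SigmaCA_mem => //; exact: lt_trans e.
    by apply: SigmaAB_mem => //; exact: lt_trans c.
  + exact: chi_bind ba bb _.
- apply: (@front_wave R sigma0 l1 l2 fCA fDC p) => //.
  + by move=> H [->|->]; exact: reg.
  + move=> h; apply: noD; left; left; left.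
    apply: filterS (corner _ _ _ _ cCA cBD cDC cAB ba bb dCADC h).
    move=> q [Dq a b [c d e]]; split.
      by apply: SigmaCA_mem => //; exact: lt_trans e.
    by apply: SigmaDC_mem => //; exact: lt_trans c.
  + by apply: chi_bind ba bb _ => q l; congr (_ && _); rewrite andbC.
- apply: (@front_wave R sigma0 l1 l2 fBD fAB p) => //.
  + by move=> H [->|->]; exact: reg.
  + move=> h; apply: noD; left; right.
    apply: filterS (corner _ _ _ _ cBD cCA cAB cDC ba bb dBDAB h).
    move=> q [Dq a b [c d e]]; split.
      by apply: SigmaAB_mem => //; exact: lt_trans c.
    by apply: SigmaBD_mem => //; exact: lt_trans e.
  + by apply: chi_bind ba bb _ => q l; congr (_ && _); rewrite andbC.
- apply: (@front_wave R sigma0 l1 l2 fBD fDC p) => //.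
  + by move=> H [->|->]; exact: reg.
  + move=> h; apply: noD; right.
    apply: filterS (corner _ _ _ _ cBD cCA cDC cAB ba bb dBDDC h).
    move=> q [Dq a b [c d e]]; split.
      by apply: SigmaBD_mem => //; exact: lt_trans e.
    by apply: SigmaDC_mem => //; exact: lt_trans c.
  + by apply: chi_bind ba bb _ => q l; congr (_ && _); rewrite andbC.
Unshelve. all: by end_near. Qed.

End Main.

Theorem theorem4p3 (R : realType) (lstar lstarstar : R) (sigma0 : R -> R) :
  2^-1 < lstar -> lstar < lstarstar -> lstarstar < 4 / 5 ->
  C1_on (2^-1) (4 / 5) sigma0 ->
  forall Omega1 : set (R * R),
    lipschitz_domain Omega1 -> Omega1 `<=` Omega0 lstar lstarstar ->
    forall t1 t2 : R,
      energy sigma0 lstar lstarstar Omega1 t1 = energy sigma0 lstar lstarstar Omega1 t2.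
Proof.
move=> l1_gt l12 l2_lt [csigma _] Omega1 _ sub t1 t2.
have cs l : l \in `[lstar, lstarstar] -> {for l, continuous sigma0}.
  rewrite in_itv /= => /andP[l1l ll2].
  apply: (@within_continuous_continuous _ _ _ 2^-1 (4 / 5)) => //; first by lra.
  by rewrite in_itv /= (lt_le_trans l1_gt) ?(le_lt_trans ll2).
have [m1 z1] := extreme_lines_null lstar ltac:(by rewrite l1_gt (lt_trans l12)).
have [m2 z2] := extreme_lines_null lstarstar ltac:(by rewrite l2_lt (lt_trans l1_gt)).
(* Off the eight lines the densities at [t1] and [t2] are the same number. *)
rewrite /energy; apply: (@ge0_eq_integral_off_null _ _ R (lebesgue_measure \x lebesgue_measure)%E Omega1
  (extreme_lines lstar `|` extreme_lines lstarstar)).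
- exact: measurableU.
- by rewrite measureU0.
- by move=> p _; rewrite lee_fin !addr_ge0// sqr_ge0.
- by move=> p _; rewrite lee_fin !addr_ge0// sqr_ge0.
move=> p /sub Op /not_orP[N1 N2].
have /standing_wave_density[e eE] := Omega0_standing_wave _ _ _ _ l1_gt l12 l2_lt cs Op N1 N2.
by rewrite !eE.
Qed.
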